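(* Consider the fluid model with parameters $\mathbf{\Lambda}$, $\lambda_0$, $\mathbf{G}$ described in the context, with $\mathbf{M}=\mathbf{G}^{-1}\mathbf{\Lambda}$. If $\rho(\mathbf{M})<1$, then the fluid model is globally stable.
   Context: Fix $K\ge 1$, a matrix $\mathbf{\Lambda}=(\lambda_{ij})_{i,j=1}^K$ with $\lambda_{ij}\ge 0$, a column vector $\lambda_0=(\lambda_{01},\dots,\lambda_{0K})^\top$ with $\lambda_{0j}\ge0$, and $\mathbf{G}=\mathrm{diag}(\mu_1,\dots,\mu_K)$ with $\mu_i\in(0,\infty)$. Set $\mathbf{M}=\mathbf{G}^{-1}\mathbf{\Lambda}$, let $\rho(\cdot)$ denote the spectral radius, and $\mathbf{I}$ the identity matrix. Fluid model. A fluid solution is a triple $(\mathbf{Q},\mathbf{T},Y)$ of functions on $[0,\infty)$, with $\mathbf{Q}=(Q_1,\dots,Q_K)^\top$, $\mathbf{T}=(T_1,\dots,T_K)^\top$, such that: each $T_i$ is nondecreasing with $T_i(0)=0$; $Y(t)=t-\sum_{i=1}^K T_i(t)$ is nondecreasing (so each $T_i$ is Lipschitz); $Q_i(t)\ge 0$ for all $i,t$; with $\mathbf{D}(t)=\mathbf{G}\mathbf{T}(t)$, $$\mathbf{Q}(t)=\mathbf{Q}(0)+(\mathbf{M}^\top-\mathbf{I})\mathbf{D}(t)+Y(t)\lambda_0,\qquad t\ge 0;$$ and the discipline is non-idling: $\sum_{i=1}^K\dot T_i(t)=1$ at almost every $t$ for which $\mathbf{Q}(t)\ne\mathbf{0}$.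 The fluid model is globally stable if there is $\delta>0$ such that for every fluid solution (i.e. under any non-idling policy) with $\|\mathbf{Q}(0)\|\le 1$ one has $\mathbf{Q}(t)=\mathbf{0}$ for all $t\ge\delta$ (here $\|\cdot\|$ is any fixed norm on $\mathbb{R}^K$). *)

(* Defs.v *)
From HB Require Import structures.
From mathcomp Require Import all_boot all_order all_algebra.
From mathcomp.real_closed Require Import complex.
From mathcomp Require Import all_classical all_reals all_analysis.
Set Implicit Arguments.
Unset Strict Implicit.
Unset Printing Implicit Defensive.
Import Order.TTheory GRing.Theory Num.Theory.
Import numFieldNormedType.Exports.
Local Open Scope classical_set_scope.
Local Open Scope ring_scope.

(* [sup] is here a maximum: for [0 < K] the set of moduli is finite and
   nonempty.  The eigenvalues are the complex ones, so [A] is first mapped to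
   the algebraically closed field [R[i]]; [eigenvalue] uses row eigenvectors,
   which give the same eigenvalues as column ones. *)
Definition spectral_radius (R : realType) (K : nat) (A : 'M[R]_K) : R :=
  sup [set ComplexField.Normc.normc z | z in
        [set z : R[i] | eigenvalue (map_mx (real_complex R) A) z]].

Record is_norm (R : realType) (K : nat) (nrm : 'cV[R]_K -> R) : Prop := {
  is_norm_triangle : forall x y, nrm (x + y) <= nrm x + nrm y ;
  is_norm_homo : forall (a : R) x, nrm (a *: x) = `|a| * nrm x ;
  is_norm_eq0 : forall x, nrm x = 0 -> x = 0
}.

Definition rate_mx (R : realType) (K : nat) (mu : 'rV[R]_K) : 'M[R]_K :=
  diag_mx mu.

Definition mean_mx (R : realType) (K : nat) (Lambda : 'M[R]_K)
    (mu : 'rV[R]_K) : 'M[R]_K :=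
  invmx (rate_mx mu) *m Lambda.

(* Functions on [0, oo) are represented by total functions on [R] whose values
   at negative times are unconstrained.  The [T i] are Lipschitz on [0, oo) by
   the first four conditions, hence differentiable almost everywhere there:
   requiring the derivatives in the non-idling condition to exist is no
   restriction, and only rules out the default value that the library gives to
   a derivative that does not exist. *)
Record fluid_solution (R : realType) (K : nat) (Lambda : 'M[R]_K)
    (lambda0 : 'cV[R]_K) (mu : 'rV[R]_K)
    (Q T : R -> 'cV[R]_K) (Y : R -> R) : Prop := {
  fluid_T_nondecreasing : forall i,
    {in `[0, +oo[ &, nondecreasing_fun (fun t => T t i 0)} ;
  fluid_T0 : forall i, T 0 i 0 = 0 ;
  fluid_Y : forall t, 0 <= t -> Y t = t - \sum_(i < K) T t i 0 ;
  fluid_Y_nondecreasing : {in `[0, +oo[ &, nondecreasing_fun Y} ;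
  fluid_Q_ge0 : forall t, 0 <= t -> forall i, 0 <= Q t i 0 ;
  fluid_balance : forall t, 0 <= t ->
    Q t = Q 0 + ((mean_mx Lambda mu)^T - 1%:M) *m (rate_mx mu *m T t)
          + Y t *: lambda0 ;
  fluid_nonidling : {ae (@lebesgue_measure R), forall t : R,
    0 <= t -> Q t != 0 ->
    (forall i, derivable (fun s => T s i 0) t 1) /\
    \sum_(i < K) derive1 (fun s => T s i 0) t = 1}
}.

Definition globally_stable (R : realType) (K : nat) (nrm : 'cV[R]_K -> R)
    (Lambda : 'M[R]_K) (lambda0 : 'cV[R]_K) (mu : 'rV[R]_K) : Prop :=
  exists2 delta : R, 0 < delta &
    forall (Q T : R -> 'cV[R]_K) (Y : R -> R),
      fluid_solution Lambda lambda0 mu Q T Y -> nrm (Q 0) <= 1 ->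
      forall t, delta <= t -> Q t = 0.

(* Main.v *)
Require Import Defs.
From HB Require Import structures.
From mathcomp Require Import all_boot all_order all_algebra.
From mathcomp.real_closed Require Import complex.
From mathcomp Require Import all_classical all_reals all_analysis.
From mathcomp Require Import ring lra.
Set Implicit Arguments.
Unset Strict Implicit.
Unset Printing Implicit Defensive.
Import Order.TTheory GRing.Theory Num.Theory.
Import numFieldNormedType.Exports.
Local Open Scope ring_scope.

(* As [rho(M) < 1], there is [v > 0] with [(I - M) v = G^-1 1].  Pairing the
   balance equation with [v] cancels the allocation: the workload
   [W t = v^T Q t] satisfies [W t = W 0 - t + (1 + v^T lambda0) Y t].  While
   [W > 0] the server is busy, so [Y] does not grow and [W] decreases at unit
   rate; hence [W t <= max (W 0 - t) 0], and [W 0] is bounded over the unit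
   ball of any norm. *)

(** * Induction over a real interval *)

(** Let [c] be the supremum of the times up to which [P] holds throughout. Closure from the left (or
    [P a]) gives [P c], and openness to the right would carry [P] beyond [c] if [c < b]. *)
Lemma real_induction (R : realType) (a b : R) (P : R -> Prop) :
  a <= b -> P a ->
  (forall t : R, a <= t < b -> P t ->
     exists2 e : R, 0 < e & forall s : R, t < s < t + e -> P s) ->
  (forall t : R, a < t <= b -> (forall s : R, a <= s < t -> P s) -> P t) ->
  P b.
Proof.
move=> ab Pa Popen Pclosed.
pose A := [set t | a <= t <= b /\ forall s : R, a <= s <= t -> P s]%classic.
have Aa : A a by split => [|s /le_anti <-//]; rewrite lexx.
have Ab : ubound A b by move=> t [/andP[]].
have supA : has_sup A by split; [exists a | exists b].
set c := sup A.
have ac : a <= c by exact: sup_upper_bound.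
have cb : c <= b by apply: ge_sup => //; exists a.
have Pltc s : a <= s < c -> P s.
  case/andP=> as_ sc; have [|t [tab Pt] ct] := @sup_adherent _ A (c - s) _ supA.
    by rewrite subr_gt0.
  by apply: Pt; rewrite as_ /= ltW //; rewrite subKr in ct.
have Pc : P c.
  have [<-//|nac] := eqVneq a c.
  by apply: Pclosed => //; rewrite cb andbT lt_neqAle nac.
have [<-//|ncb] := eqVneq c b.
have ltcb : c < b by rewrite lt_neqAle ncb.
have [|e e0 Pe] := Popen c _ Pc; first by rewrite ac.
pose d := Num.min (c + e / 2) b.
have cd : c < d by rewrite lt_min ltcb andbT ltrDl divr_gt0.
suff /(sup_upper_bound supA) : A d by rewrite leNgt cd.
split; first by rewrite (le_trans ac (ltW cd)) /= ge_min lexx orbT.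
move=> s /andP[as_ sd]; have [sc|cs|->//] := ltgtP s c.
  by apply: Pltc; rewrite as_.
apply: Pe; rewrite cs /=; apply: (le_lt_trans sd).
by rewrite gt_min ltrD2l ltr_pdivrMr // mulr_natr mulr2n ltrDl e0.
Qed.

(** * Spectral radius and norms *)

(** A [sup] is an upper bound only when one exists. Here the complex eigenvalues are roots of the
    characteristic polynomial, so the sum of the moduli of its roots dominates each of them. *)
Lemma eigenvalue_le_spectral_radius (R : realType) (K : nat) (A : 'M[R]_K)
    (a : R) :
  eigenvalue A a -> `|a| <= spectral_radius A.
Proof.
move=> Aa; pose AC := map_mx (real_complex R) A.
have [r Dr] := closed_field_poly_normal (char_poly AC).
have normc_ge0 (z : R[i]) : 0 <= ComplexField.Normc.normc z.
  by case: z => x y; exact: sqrtr_ge0.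
have -> : `|a| = ComplexField.Normc.normc (real_complex R a).
  by rewrite /= expr0n /= addr0 sqrtr_sqr.
apply: sup_upper_bound; last first.
  by exists (real_complex R a) => //=; rewrite eigenvalue_map.
split.
  exists (ComplexField.Normc.normc (real_complex R a)).
  by exists (real_complex R a) => //=; rewrite eigenvalue_map.
exists (\sum_(z <- r) ComplexField.Normc.normc z) => _ [z /= ACz <-].
have zr : z \in r.
  move: ACz; rewrite eigenvalue_root_char Dr rootZ ?root_prod_XsubC //.
  by rewrite lead_coef_eq0 monic_neq0 ?char_poly_monic.
by rewrite (big_rem z) //= lerDl sumr_ge0.
Qed.

(** One half of the equivalence of norms: [nrm] is continuous, so it has a positive minimum on the
    compact unit sphere of the sup norm, and [C] is the inverse of that minimum. *)
Lemma is_norm_bounded_coord (R : realType) (K : nat) (nrm : 'cV[R]_K -> R) :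
  is_norm nrm -> exists C, forall (x : 'cV[R]_K) i, `|x i 0| <= C * nrm x.
Proof.
move=> [nrmD nrmZ nrm0].
have nrm00 : nrm 0 = 0 by rewrite -(scale0r 0) nrmZ normr0 mul0r.
have nrmN x : nrm (- x) = nrm x by rewrite -scaleN1r nrmZ normrN1 mul1r.
have nrm_ge0 x : 0 <= nrm x.
  by have := nrmD x (- x); rewrite subrr nrm00 nrmN; lra.
pose B := \sum_i nrm (delta_mx i 0).
have B0 : 0 <= B by exact: sumr_ge0.
have le_norm (u : 'rV[R]_K) i : `|u 0 i| <= `|u|.
  rewrite [leRHS]/Num.norm /= mx_normrE; apply/bigmax_geP; right => /=.
  by exists (0, i).
have nrmB (u : 'rV[R]_K) : nrm u^T <= B * `|u|.
  rewrite (matrix_sum_delta u^T) (eq_bigr (fun i => u 0 i *: delta_mx i 0)).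
    rewrite mulr_suml; elim/big_ind2: _ => [|x a y b xa yb|i _].
    - by rewrite nrm00.
    - by rewrite (le_trans (nrmD _ _)) // lerD.
    - by rewrite nrmZ mulrC ler_wpM2l.
  by move=> i _; rewrite big_ord1 mxE.
pose S := [set u : 'rV[R]_K | `|u| = 1]%classic.
(* An empty sphere leaves no nonzero vector to normalise ([K = 0]), so [C = 0] serves. *)
have [S0|S0] := pselect (S !=set0)%classic; last first.
  exists 0 => x i; rewrite mul0r; apply: contrapT => /negP.
  rewrite -ltNge => xi.
  apply: S0; exists (`|x^T|^-1 *: x^T); rewrite /S /= normrZ normfV normr_id.
  rewrite mulVf // gt_eqF // (lt_le_trans xi) //.
  by have := le_norm x^T i; rewrite mxE.
have cS : compact S.
  apply: bounded_closed_compact.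
    exists 1; split; first exact: num_real.
    by move=> M M1 u; rewrite /S /= => ->; exact: ltW.
  rewrite (_ : S = (fun u : 'rV[R]_K => `|u|) @^-1` [set 1])%classic //.
  apply: closed_comp; last exact: closed_eq.
  by move=> u _; exact: norm_continuous.
have cnrm : continuous (fun u : 'rV[R]_K => nrm u^T).
  move=> u; have FF : Filter (nbhs u) by exact: nbhs_filter.
  apply/(@cvgrPdist_lt _ _ _ (nbhs u)) => e e0; near=> v.
  have dist x y : nrm x - nrm y <= nrm (x - y).
    by rewrite lerBlDr -{1}(subrK y x) nrmD.
  apply: (@le_lt_trans _ _ (nrm (u - v)^T)).
    rewrite ler_norml !linearB /= dist andbT lerNl opprB.
    by rewrite -(nrmN (u^T - v^T)) opprB dist.
  apply: (le_lt_trans (nrmB _)); apply: (@le_lt_trans _ _ ((B + 1) * `|u - v|)).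
    by rewrite ler_wpM2r // lerDl.
  rewrite mulrC -ltr_pdivlMr; last by lra.
  by near: v; apply: cvgr_dist_lt => //; rewrite divr_gt0 //; lra.
have [c] := @EVT_min_rV _ _ _ S S0 cS (continuous_subspaceT cnrm).
rewrite inE /S /= => c1 cmin.
have c0 : 0 < nrm c^T.
  rewrite lt_neqAle nrm_ge0 andbT; apply/eqP => /esym/nrm0/(congr1 trmx).
  by rewrite trmxK trmx0 => c00; move: c1; rewrite c00 normr0; lra.
exists (nrm c^T)^-1 => x i; rewrite ler_pdivlMl //.
have := le_norm x^T i; rewrite mxE => xi.
have [x0|x0] := eqVneq `|x^T| 0.
  have -> : `|x i 0| = 0 by apply: le_anti; rewrite normr_ge0 -[leRHS]x0 xi.
  by rewrite mulr0.
have x0' : 0 < `|x^T| by rewrite lt_neqAle eq_sym x0 normr_ge0.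
apply: (@le_trans _ _ (nrm c^T * `|x^T|)); first by rewrite ler_wpM2l // ltW.
have := cmin (`|x^T|^-1 *: x^T).
rewrite inE /S /= normrZ normfV normr_id mulVf // => /(_ erefl).
by rewrite linearZ /= trmxK nrmZ normfV normr_id ler_pdivlMl // mulrC.
Unshelve. all: by end_near.
Qed.

(** * Positive solution of the resolvent equation *)

Lemma ge0_left_limit (R : realType) (f : R -> R) (a t : R) :
  {for t, continuous f} -> a < t -> (forall s : R, a <= s < t -> 0 <= f s) ->
  0 <= f t.
Proof.
move=> cf at_ f0; rewrite leNgt; apply/negP => ft.
have /nbhs_ballP[e /= e0 He] : (\forall s \near t, f s < 0)%classic.
  exact: cvgr_lt cf _ ft.
pose s := Num.max a (t - e / 2).
have st : s < t by rewrite gt_max at_ /= ltrBlDr ltrDl divr_gt0.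
have : f s < 0.
  apply: He; rewrite /ball /= gtr0_norm ?subr_gt0 // ltrBlDr -ltrBlDl.
  by rewrite lt_max ltrD2l ltrN2 ltr_pdivrMr // mulr_natr mulr2n ltrDl e0 orbT.
by rewrite ltNge f0 // st le_max lexx.
Qed.

(* Only the real eigenvalues [a >= 1] matter: along [t] in [0, 1] the vector
   [u t = \adj (1 - t M) b] starts at [b > 0], and as
   [\det (1 - t M) b = u t - t M (u t)] no coordinate of [u t] can reach 0
   before [\det (1 - t M)] does. *)
Lemma resolvent_gt0 (R : realType) (K : nat) (M : 'M[R]_K) (b : 'cV[R]_K) :
  (forall i j, 0 <= M i j) -> (forall i, 0 < b i 0) ->
  (forall a : R, 1 <= a -> ~~ eigenvalue M a) ->
  exists2 v : 'cV[R]_K, forall i, 0 < v i 0 & v - M *m v = b.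
Proof.
move=> M0 b0 Meig.
(* Over [{poly R}] the determinant and the adjugate have polynomial entries in [t], which makes them
   continuous in [t]. *)
pose N : 'M[{poly R}]_K := 1%:M - 'X *: map_mx polyC M.
pose p := \det N; pose u := \adj N *m map_mx polyC b.
have NE t : map_mx (horner_eval t) N = 1%:M - t *: M.
  apply/matrixP => i j; rewrite !mxE /horner_eval /= !hornerE.
  by case: (i == j); rewrite !hornerE.
have pE t : p.[t] = \det (1%:M - t *: M) by rewrite -NE det_map_mx.
pose ut t := map_mx (horner_eval t) u.
have utE t i : (u i 0).[t] = ut t i 0 by rewrite [RHS]mxE.
have utD t : ut t - t *: (M *m ut t) = p.[t] *: b.
  rewrite scalemxAl -{1}[ut t]mul1mx -mulmxBl -NE -map_mxM mulmxA mul_mx_adj.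
  rewrite mul_scalar_mx map_mxZ; congr (_ *: _).
  by apply/matrixP => i j; rewrite !mxE; exact: hornerC.
(* A nonzero row vector killed by [1 - t M] is an eigenvector for [t^-1 >= 1]. *)
have p_neq0 t : 0 < t <= 1 -> p.[t] != 0.
  case/andP=> t0 t1; rewrite pE; apply/det0P => -[w w0].
  rewrite mulmxBr mulmx1 -scalemxAr => /eqP; rewrite subr_eq0 => /eqP wM.
  have /negP[] : ~~ eigenvalue M t^-1 by apply: Meig; rewrite invf_ge1.
  apply/eigenvalueP; exists w => //.
  by rewrite {2}wM scalerA mulVf ?scale1r // gt_eqF.
have [] := @real_induction R 0 1
    (fun t => 0 < p.[t] /\ forall i, 0 < (u i 0).[t]).
- exact: ler01.
- have p0 : p.[0] = 1 by rewrite pE scale0r subr0 det1.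
  rewrite p0; split => // i; have := utD 0.
  by rewrite scale0r subr0 p0 scale1r utE => ->.
- move=> t _ [pt ut0].
  have : (\forall s \near t, 0 < p.[s] /\ forall i, 0 < (u i 0).[s])%classic.
    have near_gt0 (q : {poly R}) : 0 < q.[t] ->
        (\forall s \near t, 0 < q.[s])%classic.
      exact: (cvgr_gt q.[t] (@continuous_horner _ q t)).
    apply: filterI; first exact: near_gt0.
    apply: (@filter_forall _ _ (fun i (s : R) => 0 < (u i 0).[s])
      (nbhs (t : R)) _) => i.
    exact: near_gt0.
  case/nbhs_ballP=> e /= e0 He; exists e => // s /andP[ts se].
  by apply: He; rewrite /ball /= ltr_norml; apply/andP; split; lra.
- move=> t /[dup] /p_neq0 pt /andP[t0 t1] IH.
  have pt0 : 0 < p.[t].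
    rewrite lt_neqAle eq_sym pt /=.
    apply: (ge0_left_limit (@continuous_horner _ p t) t0) => s /IH[ps _].
    exact: ltW.
  have ut_ge0 i : 0 <= ut t i 0.
    rewrite -utE; apply: (ge0_left_limit (@continuous_horner _ _ t) t0) => s.
    by case/IH => _ /(_ i)/ltW.
  (* In [u t = p(t) b + t M (u t)] the last term is nonnegative and the first is positive. *)
  split=> // i; rewrite utE.
  have := congr1 (fun x : 'cV[R]_K => x i 0) (utD t).
  rewrite !mxE => /eqP; rewrite subr_eq => /eqP ->.
  rewrite ltr_pwDl ?mulr_gt0 ?mulr_ge0 ?(ltW t0) // sumr_ge0 // => j _.
  by rewrite mulr_ge0.
move=> p1 u1; exists (p.[1]^-1 *: ut 1) => [i|].
  by rewrite mxE mulr_gt0 ?invr_gt0 // -utE.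
rewrite -scalemxAr -scalerBr.
have := utD 1; rewrite scale1r => ->.
by rewrite scalerA mulVf ?scale1r // gt_eqF.
Qed.

(** * Decay of the workload *)

(** Outer regularity encloses [N] in an open [U] of measure at most [eps]; [g t] is the measure of
    the part of [U] up to [t], which grows at unit rate inside [U]. *)
Lemma negligible_growth (R : realType) (N : set R) (eps : R) : 0 < eps ->
  (@lebesgue_measure R).-negligible N ->
  exists g : R -> R, [/\ forall t : R, 0 <= g t <= eps,
    forall s t : R, s <= t -> g s <= g t &
    forall t : R, N t ->
      exists2 e : R, 0 < e & forall s : R, t < s < t + e -> s - t <= g s - g t].
Proof.
move=> eps0 [Z [mZ Z0 NZ]]; set mu := (@lebesgue_measure R).
have [|U [oU ZU UZ]] := lebesgue_regularity_outer mZ _ eps0.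
  by rewrite [X in (X < _)%E]Z0.
have mU : measurable U by exact: measurable_realfun.open_measurable.
have muU : (mu U <= eps%:E)%E.
  rewrite -(setDUK ZU) (le_trans (measureU2 _ _ _)) //.
    exact: measurableD.
  by rewrite [X in (X + _)%E]Z0 add0e ltW.
pose I t := (U `&` `]-oo, t])%classic.
have mI t : measurable (I t) by exact: measurableI.
have IU t : (mu (I t) <= eps%:E)%E.
  apply: le_trans muU; rewrite le_measure ?inE //; first exact: mI.
  exact: subIsetl.
have fin t : mu (I t) \is a fin_num.
  by rewrite ge0_fin_numE // (le_lt_trans (IU t)) // ltry.
have le_I s t : s <= t -> fine (mu (I s)) <= fine (mu (I t)).
  move=> st; rewrite fine_le // le_measure ?inE //; [exact: mI | exact: mI |].
  by apply: setIS => x /=; rewrite !in_itv /= => /le_trans; apply.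
exists (fun t => fine (mu (I t))); split=> // [t|t /NZ/ZU Ut].
  by rewrite fine_ge0 //= -lee_fin fineK.
have /nbhs_ballP[e /= e0 He] := open_nbhs_nbhs (conj oU Ut).
exists e => // s /andP[ts se].
rewrite lerBrDr -lee_fin EFinD !fineK //.
have -> : (s - t)%:E = mu `]t, s]%classic.
  by rewrite /mu lebesgue_measure_itv /= lte_fin ts EFinB.
rewrite -measureU //=; [|exact: mI|].
  apply: le_measure; rewrite ?inE.
  - by apply: measurableU; [|exact: mI].
  - exact: mI.
  move=> x [] /=; last first.
    case=> Ux; rewrite /I /= !in_itv /= => xt; split => //.
    exact: (le_trans xt (ltW ts)).
  rewrite in_itv /= => /andP[tx xs]; split; last by rewrite /= in_itv.
  by apply: He; rewrite /ball /= ltr_norml; apply/andP; split; lra.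
apply/seteqP; split => // x [] /=; rewrite in_itv /= => /andP[tx _] [_] /=.
by rewrite in_itv /= leNgt tx.
Qed.

Lemma is_derive0_growth (R : realType) (F : R -> R) (t eps : R) :
  is_derive t 1 F 0 -> 0 < eps ->
  exists2 e : R, 0 < e &
    forall s : R, t < s < t + e -> F s - F t <= eps * (s - t).
Proof.
move=> [dF F0] eps0; move: (dF); rewrite /derivable => cF.
have limF : lim ((fun h => h^-1 *: (F (h *: 1 + t) - F t)) @ 0^')%classic = 0.
  by move: F0; rewrite /derive.
have /cvgrPdist_lt/(_ _ eps0) := cF; rewrite limF.
case/nbhs_ballP=> e /= e0 He; exists e => // s /andP[ts se].
have h0 : 0 < s - t by rewrite subr_gt0.
have := He (s - t); rewrite /ball /= !sub0r !normrN gtr0_norm //.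
rewrite gt_eqF // => /(_ _ isT); rewrite ltrBlDl => /(_ se).
rewrite /GRing.scale /= mulr1 subrK => /ltr_normlW.
by rewrite ltr_pdivrMl // mulrC => /ltW.
Qed.

(* Once the slack [d / 2 + c (r t + g t)] is added, where [g] grows at unit rate
   through the exceptional null set, the bound propagates to the right at every
   time, so real induction applies although [Y'] is only known almost
   everywhere. *)
Lemma workload_decay (R : realType) (w c T : R) (Y : R -> R) :
  0 <= w -> 0 < c -> 0 <= T -> Y 0 = 0 ->
  (forall s t : R, 0 <= s <= t -> 0 <= Y t - Y s <= t - s) ->
  {ae (@lebesgue_measure R), forall t : R, 0 < t -> 0 < w - t + c * Y t ->
     is_derive t 1 Y 0} ->
  w - T + c * Y T <= Num.max (w - T) 0.
Proof.
move=> w0 c0 T0 Y0 Ylip Yae.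
suff Wd (d : R) : 0 < d -> w - T + c * Y T <= Num.max (w - T) 0 + d.
  by apply/ler_addgt0Pr => d; exact: Wd.
move=> d0.
(* As [g <= r], this choice gives [c (r T + g T) <= c r (T + 1) = d / 2]; the other half of [d] is
   the constant term of [phi]. *)
pose r := d / 2 / c / (T + 1).
have r0 : 0 < r by rewrite !divr_gt0 //; lra.
have [g [gr gmono gN]] := negligible_growth r0 Yae.
pose m t := Num.max (w - t) 0.
have mdec (s t : R) : s <= t -> m t <= m s <= m t + (t - s).
  move=> st; rewrite /m; case: (leP (w - t) 0) => ?;
    case: (leP (w - s) 0) => ?; apply/andP; split; lra.
pose phi t := w - t + c * Y t - m t - d / 2 - c * (r * t + g t).
(* [m] falls at rate at most 1, so the drift [- t] outweighs the growth of [- m t]. *)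
have phiB (s t : R) : 0 <= s <= t ->
    phi t - phi s <= c * (Y t - Y s - r * (t - s) - (g t - g s)).
  by case/andP=> _ /mdec; rewrite /phi; lra.
have phi_lip (s t : R) : 0 <= s <= t -> phi t - phi s <= c * (t - s).
  move=> st; apply: (le_trans (phiB _ _ st)); rewrite ler_pM2l //.
  have := Ylip _ _ st; case/andP: st => _ st.
  have := gmono _ _ st; have : 0 <= r * (t - s).
    by apply: mulr_ge0 (ltW r0) _; rewrite subr_ge0.
  lra.
have phi0 : phi 0 < 0.
  have /andP[g0 _] := gr 0; have := mulr_ge0 (ltW c0) g0.
  by rewrite /phi /m Y0 !subr0 !mulr0 add0r addr0 max_l //; lra.
suff : phi T <= 0.
  have : c * (r * T + g T) <= d / 2.
    rewrite mulrC -ler_pdivlMr //.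
    have /andP[_ gT] := gr T.
    apply: (@le_trans _ _ (r * T + r)); first by rewrite lerD2l.
    rewrite -{2}[r]mulr1 -mulrDr /r divfK //; lra.
  by rewrite /phi -/(m T); lra.
apply: (@real_induction R 0 T (fun t => phi t <= 0)) => //; first exact: ltW.
(* If [phi t < 0], the one-sided Lipschitz bound keeps [phi] nonpositive for a time [- phi t / c];
   only [phi t = 0] needs the derivative of [Y]. *)
- move=> t /andP[t0 tT] phit; have [phit0|] := ltP (phi t) 0.
    exists (- phi t / c) => [|s /andP[ts se]].
      by rewrite divr_gt0 // oppr_gt0.
    have := phi_lip t s; rewrite t0 ltW // => /(_ isT).
    have : c * (s - t) <= - phi t by rewrite mulrC -ler_pdivlMr //; lra.
    lra.
  move=> phit0; have {phit0}phit : phi t = 0 by apply: le_anti; rewrite phit.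
  (* Time 0, about which the derivative hypothesis says nothing, is excluded by [phi 0 < 0]. *)
  have tpos : 0 < t.
    rewrite lt_neqAle t0 andbT eq_sym; apply/eqP => t00.
    by move: phit phi0; rewrite t00; lra.
  (* At [phi t = 0] the workload is [m t] plus the slack, hence at least [d / 2]. *)
  have Wpos : 0 < w - t + c * Y t.
    have /andP[gt0 _] := gr t.
    have : 0 <= c * (r * t + g t).
      apply: mulr_ge0 (ltW c0) _; apply: addr_ge0 gt0.
      exact: mulr_ge0 (ltW r0) t0.
    have : 0 <= m t by rewrite /m le_max lexx orbT.
    by move: phit; rewrite /phi; lra.
  (* At a good time the growth of [Y] is absorbed by [r t]; at a bad time [Y] grows at most at unit
     rate, and [g] absorbs that. *)
  have [good|bad] := pselect
      (0 < t -> 0 < w - t + c * Y t -> is_derive t 1 Y 0).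
    have [e e0 He] := is_derive0_growth (good tpos Wpos) r0.
    exists e => // s /[dup] /He Ys /andP[ts _].
    have := phiB t s; rewrite t0 ltW // phit subr0 => /(_ isT)/le_trans; apply.
    by rewrite pmulr_rle0 //; have := gmono t s (ltW ts); lra.
  have [e e0 He] := gN t bad.
  exists e => // s /[dup] /He gs /andP[ts _].
  have ts0 : 0 <= t <= s by rewrite t0 ltW.
  have := phiB t s ts0; rewrite phit subr0 => /le_trans; apply.
  rewrite pmulr_rle0 //; have /andP[_ Ys] := Ylip t s ts0.
  have rs : 0 <= r * (s - t).
    by apply: mulr_ge0 (ltW r0) _; rewrite subr_ge0 ltW.
  lra.
- move=> t /andP[t0 tT] IH; rewrite leNgt; apply/negP => phit.
  (* Going back by at most [phi t / (2 c)] costs at most half of [phi t], so [phi s] is still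
     positive. *)
  pose s := Num.max 0 (t - phi t / 2 / c).
  have st : s < t by rewrite gt_max t0 ltrBlDr ltrDl !divr_gt0.
  have s0 : 0 <= s by rewrite le_max lexx.
  have := phi_lip s t; rewrite s0 ltW // => /(_ isT).
  have : c * (t - s) <= phi t / 2.
    rewrite mulrC -ler_pdivlMr // lerBlDr -lerBlDl.
    by rewrite le_max lexx orbT.
  by have := IH s; rewrite s0 st => /(_ isT); lra.
Qed.

(** * Workload identity and global stability *)

Lemma mean_mxE (R : realType) (K : nat) (Lambda : 'M[R]_K) (mu : 'rV[R]_K) :
  (forall i, 0 < mu 0 i) ->
  forall i j, mean_mx Lambda mu i j = (mu 0 i)^-1 * Lambda i j.
Proof.
move=> mu0 i j.
have inv : diag_mx (\row_k (mu 0 k)^-1) *m rate_mx mu = 1%:M.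
  rewrite mulmx_diag -diag_const_mx; congr diag_mx.
  by apply/rowP => k; rewrite !mxE mulVf // gt_eqF.
have /mulmx1_unit[_ uG] := inv.
rewrite /mean_mx (_ : invmx _ = diag_mx (\row_k (mu 0 k)^-1)).
  by rewrite mul_diag_mx !mxE.
by rewrite -[LHS]mul1mx -inv mulmxK.
Qed.

(** Paired with [v], the term [(M^T - I) G T] becomes minus the total busy time, that is [Y t - t]:
    a unit of service removes a unit of workload, whichever class receives it. *)
Lemma workload_balance (R : realType) (K : nat) (Lambda : 'M[R]_K)
    (lambda0 : 'cV[R]_K) (mu : 'rV[R]_K) (v : 'cV[R]_K)
    (Q T : R -> 'cV[R]_K) (Y : R -> R) (t : R) :
  (forall i, 0 < mu 0 i) ->
  v - mean_mx Lambda mu *m v = \col_i (mu 0 i)^-1 ->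
  fluid_solution Lambda lambda0 mu Q T Y -> 0 <= t ->
  (v^T *m Q t) 0 0 =
    (v^T *m Q 0) 0 0 - t + (1 + (v^T *m lambda0) 0 0) * Y t.
Proof.
move=> mu0 vE sol t0; rewrite (fluid_balance sol t0) !mulmxDr -scalemxAr.
have -> : v^T *m (((mean_mx Lambda mu)^T - 1%:M) *m (rate_mx mu *m T t)) =
    - (\sum_i T t i 0)%:M.
  rewrite mulmxA mulmxBr mulmx1 -trmx_mul -linearB /= -opprB vE linearN /=.
  rewrite mulNmx; congr (- _); apply/matrixP => i j; rewrite !ord1 !mxE mulr1n.
  apply: eq_bigr => k _; rewrite mul_diag_mx !mxE mulrA mulVf ?mul1r //.
  by rewrite gt_eqF.
rewrite (fluid_Y sol t0) !mxE mulr1n; ring.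
Qed.

Theorem corollary2 (R : realType) (K : nat) (K_gt0 : (0 < K)%N)
    (Lambda : 'M[R]_K) (Lambda_ge0 : forall i j, 0 <= Lambda i j)
    (lambda0 : 'cV[R]_K) (lambda0_ge0 : forall j, 0 <= lambda0 j 0)
    (mu : 'rV[R]_K) (mu_gt0 : forall i, 0 < mu 0 i)
    (nrm : 'cV[R]_K -> R) (nrm_norm : is_norm nrm) :
  spectral_radius (mean_mx Lambda mu) < 1 ->
  globally_stable nrm Lambda lambda0 mu.
Proof.
move=> rho1.
have [||a a1|v v0 vE] :=
    @resolvent_gt0 R K (mean_mx Lambda mu) (\col_i (mu 0 i)^-1).
- by move=> i j; rewrite mean_mxE // mulr_ge0 // invr_ge0 ltW.
- by move=> i; rewrite mxE invr_gt0.
- apply/negP => /eigenvalue_le_spectral_radius.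
  by rewrite leNgt (lt_le_trans rho1) // (le_trans a1) // ler_norm.
have [C HC] := is_norm_bounded_coord nrm_norm.
have vC0 : 0 <= \sum_i v i 0 * `|C|.
  by apply: sumr_ge0 => i _; rewrite mulr_ge0 // ltW.
(* The sum bounds the initial workload [w]; adding 1 makes [delta] positive and [w - t] negative for
   [t >= delta]. *)
exists (\sum_i v i 0 * `|C| + 1); first by lra.
move=> Q T Y sol nrmQ t tge.
pose w := (v^T *m Q 0) 0 0; pose c := 1 + (v^T *m lambda0) 0 0.
have W s : (v^T *m Q s) 0 0 = \sum_i v i 0 * Q s i 0.
  by rewrite mxE; apply: eq_bigr => i _; rewrite mxE.
have w0 : 0 <= w.
  rewrite /w W sumr_ge0 // => i _.
  by rewrite mulr_ge0 ?(fluid_Q_ge0 sol) // ltW.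
have c0 : 0 < c.
  rewrite ltr_pwDl // mxE sumr_ge0 // => i _.
  by rewrite mxE mulr_ge0 // ltW.
have t0 : 0 <= t by lra.
(* [F] extends the formula for [Y] to negative times, so its derivative follows from the sum
   rule. *)
pose F (s : R) := s - \sum_i T s i 0.
have WF s : 0 <= s -> (v^T *m Q s) 0 0 = w - s + c * F s.
  by move=> s0; rewrite (workload_balance mu_gt0 vE sol s0) (fluid_Y sol s0).
have Wt : (v^T *m Q t) 0 0 <= Num.max (w - t) 0.
  rewrite WF //; apply: workload_decay => //.
  - by rewrite /F big1 ?subr0 // => i _; exact: fluid_T0 sol i.
  - move=> r s /andP[r0 rs]; have s0 := le_trans r0 rs.
    have rI : r \in `[0, +oo[ by rewrite in_itv /= r0.
    have sI : s \in `[0, +oo[ by rewrite in_itv /= s0.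
    apply/andP; split.
      rewrite subr_ge0 /F -(fluid_Y sol r0) -(fluid_Y sol s0).
      exact: (fluid_Y_nondecreasing sol rI sI rs).
    have : \sum_i T r i 0 <= \sum_i T s i 0.
      apply: ler_sum => i _; exact: (fluid_T_nondecreasing sol i rI sI rs).
    by rewrite /F; lra.
  (* Positive workload forces [Q s != 0]; outside the null set of the non-idling condition the [T i]
     then have derivatives summing to 1, so [F] has derivative 0. *)
  - apply: negligibleS (fluid_nonidling sol) => s; apply: contra_not => Hs s0.
    rewrite -WF ?(ltW s0) // => Ws.
    have [|dT sumT] := Hs (ltW s0).
      by apply: contraTneq Ws => ->; rewrite mulmx0 mxE ltxx.
    have -> : F = (id - \sum_(i < K) (fun r => T r i 0) : R -> R).
      by apply/funext => r; rewrite /F !fctE fct_sumE.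
    have -> : 0 = 1 - \sum_(i < K) derive1 (fun r => T r i 0) s.
      by rewrite sumT subrr.
    apply: is_deriveB; apply: is_derive_sum => i; rewrite derive1E.
    exact: DeriveDef.
have wle : w <= \sum_i v i 0 * `|C|.
  rewrite /w W ler_sum // => i _; rewrite ler_wpM2l //; first exact: ltW.
  apply: (le_trans (ler_norm _)); apply: (le_trans (HC _ _)).
  have nrmQ0 : 0 <= nrm (Q 0).
    case: nrm_norm => nD nZ _; have := nD (Q 0) (- Q 0).
    by rewrite subrr -scaleN1r -(scale0r (Q 0)) !nZ normr0 normrN1; lra.
  apply: (le_trans (ler_wpM2r nrmQ0 (ler_norm C))).
  by rewrite ler_piMr.
have Qge0 i : 0 <= v i 0 * Q t i 0.
  by rewrite mulr_ge0 ?(fluid_Q_ge0 sol) // ltW.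
move: Wt; rewrite max_r; last by lra.
rewrite W => W0; apply/colP => i; rewrite [RHS]mxE.
have : \sum_i v i 0 * Q t i 0 == 0 by rewrite eq_le W0 sumr_ge0.
rewrite psumr_eq0 // => /allP/(_ i); rewrite mem_index_enum => /(_ isT) /=.
by rewrite mulf_eq0 gt_eqF //= => /eqP.
Qed.
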